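(* Let $\mathcal V$ be the Virasoro algebra, i.e. the complex Lie algebra with basis $\{L_n, C_0\mid n\in\mathbb Z\}$, where $C_0$ is central and $[L_m,L_n]=(m-n)L_{m+n}+\frac{1}{12}(m^3-m)\delta_{m+n,0}C_0$ for $m,n\in\mathbb Z$ (with $\delta_{m+n,0}$ the Kronecker delta). For $\delta\in\mathbb C$ let $\mathfrak{BD}^{[\delta]}(\mathcal V)$ be the space of $\delta$-biderivations of $\mathcal V$, and let $\widetilde\pi:\mathcal V\times\mathcal V\to\mathcal V$ be the bilinear map $\widetilde\pi(x,y)=[x,y]$. Then $$\mathfrak{BD}^{[\delta]}(\mathcal V)=\begin{cases}\mathbb C\,\widetilde\pi & \text{if }\delta=1;\\ 0 & \text{otherwise.}\end{cases}$$
   Context: All vector spaces are over $\mathbb C$. For $\delta\in\mathbb C$ and a Lie algebra $\mathcal L$, a $\delta$-biderivation of $\mathcal L$ is a bilinear map $f:\mathcal L\times\mathcal L\to\mathcal L$ such that for all $x,y,z\in\mathcal L$: $\delta[x,f(y,z)]+\delta[f(x,z),y]=f([x,y],z)$ and $\delta[f(x,y),z]+\delta[y,f(x,z)]=f(x,[y,z])$. The space of $\delta$-biderivations of $\mathcal L$ (for fixed $\delta$) is denoted $\mathfrak{BD}^{[\delta]}(\mathcal L)$. *)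

(* Defs.v *)
From HB Require Import structures.
From mathcomp Require Import all_boot all_order all_algebra.
From mathcomp Require Import ring zify.
From mathcomp Require Import all_classical reals.
From mathcomp Require Import complex freeg.

Set Implicit Arguments.
Unset Strict Implicit.
Unset Printing Implicit Defensive.

Import GRing.Theory.

Local Open Scope ring_scope.

HB.mixin Record Lmodule_isLieAlgebra (K : comNzRingType) L
    of GRing.Lmodule K L := {
  lie_bracket : L -> L -> L ;
  lie_bilinear : bilinear_for *:%R *:%R lie_bracket ;
  lie_alternating : forall x, lie_bracket x x = 0 ;
  lie_jacobi : forall x y z,
    lie_bracket x (lie_bracket y z) + lie_bracket y (lie_bracket z x)
      + lie_bracket z (lie_bracket x y) = 0
}.

#[short(type="lieAlgType")]
HB.structure Definition LieAlgebra (K : comNzRingType) :=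
  {L of GRing.Lmodule K L & Lmodule_isLieAlgebra K L}.

Notation "[lie x , y ]" := (lie_bracket x y)
  (at level 0, x, y at level 99, format "[lie  x ,  y ]") : ring_scope.

Section Biderivations.
Variables (K : comNzRingType) (L : lieAlgType K) (delta : K).

Definition delta_biderivation (f : L -> L -> L) : Prop :=
  [/\ bilinear_for *:%R *:%R f,
      forall x y z,
        delta *: [lie x, f y z] + delta *: [lie f x z, y] = f [lie x, y] z
    & forall x y z,
        delta *: [lie f x y, z] + delta *: [lie y, f x z] = f x [lie y, z]].

Definition delta_biderivations : set (L -> L -> L) :=
  [set f | delta_biderivation f]%classic.

End Biderivations.

Arguments delta_biderivations {K} L delta.

(* The basis is indexed by [option int]: [Some n] is the index of L_n and     *)
(* [None] the index of C_0.                                                   *)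
Definition virasoro (K : fieldType) : Type := {freeg (option int) / K}.

HB.instance Definition _ (K : fieldType) :=
  GRing.Lmodule.on (virasoro K).

Section Virasoro.
Variable K : fieldType.

Definition vir_L (n : int) : virasoro K := << Some n >>.
Definition vir_C : virasoro K := << None >>.

Definition vir_basis_bracket (a b : option int) : virasoro K :=
  match a, b with
  | Some m, Some n =>
      (m - n)%:~R *: vir_L (m + n)
      + ((m ^+ 3 - m)%:~R / 12%:R * (m + n == 0)%:R) *: vir_C
  | _, _ => 0
  end.

Definition vir_bracket (x y : virasoro K) : virasoro K :=
  fglift (fun a => fglift (vir_basis_bracket a) y) x.

Lemma fglift_linear (M : lmodType K) (T : choiceType) (f : T -> M) :
  linear (fglift f : {freeg T / K} -> M).
Proof.
have liftB := lift_is_additive f.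
pose g : {additive {freeg T / K} -> M} := HB.pack (fglift f : {freeg T / K} -> M)
  (GRing.isZmodMorphism.Build _ _ _ liftB).
have gU k t : g << k *g t >> = k *: f t by exact: liftU.
move=> c x y; rewrite -[fglift f]/(g : _ -> _) raddfD; congr (_ + _).
rewrite -[X in _ = c *: g X](freeg_sumE x) [c *: x]/(fgscale c x) /fgscale.
rewrite !(raddf_sum g) scaler_sumr.
by apply: eq_bigr => t _; rewrite !gU scalerA.
Qed.

Lemma vir_bracket_bilinear : bilinear_for *:%R *:%R vir_bracket.
Proof.
split=> [y|x]; first exact: fglift_linear.
move=> c y z; rewrite /vir_bracket.
elim/freeg_ind_dom0: x => [|k a x _ _ IHx].
  have E (f : option int -> virasoro K) : fglift f 0 = 0.
    by rewrite -[0 in LHS]/([freeg [::]] : {freeg (option int) / K}) fglift_Freeg prelift_nil.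
  by rewrite !E /= scaler0 addr0.
have E (f : option int -> virasoro K) : fglift f (<< k *g a >> + x)
    = k *: f a + fglift f x.
  by have := fglift_linear f 1 << k *g a >> x; rewrite /= !scale1r liftU.
rewrite !E IHx fglift_linear /=.
by rewrite !scalerDr !scalerA [k * c]mulrC addrACA.
Qed.

Lemma vir_bracketDl x y z :
  vir_bracket (x + y) z = vir_bracket x z + vir_bracket y z.
Proof. by have /= := vir_bracket_bilinear.1 z 1 x y; rewrite !scale1r. Qed.

Lemma vir_bracketDr x y z :
  vir_bracket x (y + z) = vir_bracket x y + vir_bracket x z.
Proof. by have /= := vir_bracket_bilinear.2 x 1 y z; rewrite !scale1r. Qed.

Lemma vir_bracket0l z : vir_bracket 0 z = 0.
Proof.
by apply: (addrI (vir_bracket 0 z)); rewrite -vir_bracketDl !addr0.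
Qed.

Lemma vir_bracket0r z : vir_bracket z 0 = 0.
Proof.
by apply: (addrI (vir_bracket z 0)); rewrite -vir_bracketDr !addr0.
Qed.

Lemma vir_bracketZl c x z : vir_bracket (c *: x) z = c *: vir_bracket x z.
Proof.
by have /= := vir_bracket_bilinear.1 z c x 0; rewrite vir_bracket0l !addr0.
Qed.

Lemma vir_bracketZr c x z : vir_bracket z (c *: x) = c *: vir_bracket z x.
Proof.
by have /= := vir_bracket_bilinear.2 z c x 0; rewrite vir_bracket0r !addr0.
Qed.

Lemma vir_bracketU a b : vir_bracket << a >> << b >> = vir_basis_bracket a b.
Proof. by rewrite /vir_bracket !liftU !scale1r. Qed.

Lemma vir_bracketLL m n :
  vir_bracket (vir_L m) (vir_L n) = (m - n)%:~R *: vir_L (m + n)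
    + ((m ^+ 3 - m)%:~R / 12%:R * (m + n == 0)%:R) *: vir_C.
Proof. exact: vir_bracketU. Qed.

Lemma virasoro_ind (P : virasoro K -> Prop) :
  P 0 -> (forall a, P << a >>) -> (forall c x, P x -> P (c *: x)) ->
  (forall x y, P x -> P y -> P (x + y)) -> forall x, P x.
Proof.
move=> P0 PU PZ PD x; elim/freeg_ind_dom0: x => // k a x _ _ IHx.
apply: PD IHx.
suff -> : << k *g a >> = k *: (<< a >> : virasoro K) by exact: PZ.
by apply/eqP/freeg_eqP => b; rewrite coeffZ !coeffU mul1r.
Qed.

Lemma vir_bracketC x y : vir_bracket x y + vir_bracket y x = 0.
Proof.
elim/virasoro_ind: x => [|a|c x IHx|x x' IHx IHx'].
- by rewrite vir_bracket0l vir_bracket0r addr0.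
- elim/virasoro_ind: y => [|b|c y IHy|y y' IHy IHy'].
  + by rewrite vir_bracket0l vir_bracket0r addr0.
  + rewrite !vir_bracketU; case: a b => [m|] [n|] /=; rewrite ?addr0 //.
    rewrite [n + m]addrC addrACA -!scalerDl.
    have -> : (m - n)%:~R + (n - m)%:~R = 0 :> K by rewrite -intrD; ring.
    case: eqP => [mn0|_]; last by rewrite !mulr0 addr0 !scale0r addr0.
    have -> : n = - m by apply/eqP; rewrite -addr_eq0 addrC mn0.
    rewrite !mulr1 -mulrDl -intrD scale0r add0r.
    have -> : m ^+ 3 - m + ((- m) ^+ 3 - - m) = 0 by ring.
    by rewrite mul0r scale0r.
  + by rewrite vir_bracketZl vir_bracketZr -scalerDr IHy scaler0.
  + by rewrite vir_bracketDl vir_bracketDr addrACA IHy IHy' addr0.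
- by rewrite vir_bracketZl vir_bracketZr -scalerDr IHx scaler0.
- by rewrite vir_bracketDl vir_bracketDr addrACA IHx IHx' addr0.
Qed.

Lemma vir_bracket_alternating x : vir_bracket x x = 0.
Proof.
elim/virasoro_ind: x => [|a|c x IHx|x y IHx IHy].
- exact: vir_bracket0l.
- rewrite vir_bracketU; case: a => [m|] //=; rewrite subrr scale0r add0r.
  rewrite (_ : _ * _ = 0) ?scale0r //; case: eqP => [m0|_]; last by rewrite mulr0.
  have -> : m = 0 by lia.
  by rewrite expr0n subrr !mul0r.
- by rewrite vir_bracketZl vir_bracketZr IHx !scaler0.
- by rewrite vir_bracketDl !vir_bracketDr IHx IHy addr0 add0r vir_bracketC.
Qed.

Let J x y z := vir_bracket x (vir_bracket y z) + vir_bracket y (vir_bracket z x)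
  + vir_bracket z (vir_bracket x y).

Let JC x y z : J x y z = J y z x.
Proof. by rewrite /J [RHS]addrC addrA. Qed.

Let J_basis y z : (forall a, J << a >> y z = 0) -> forall x, J x y z = 0.
Proof.
move=> JU; elim/virasoro_ind => [|//|c x IHx|x x' IHx IHx'].
- by rewrite /J !(vir_bracket0l, vir_bracket0r) !addr0.
- rewrite /J !(vir_bracketZl, vir_bracketZr) -!scalerDr -/(J x y z).
  by rewrite IHx scaler0.
- transitivity (J x y z + J x' y z); last by rewrite IHx IHx' addr0.
  rewrite /J !(vir_bracketDl, vir_bracketDr) [RHS]addrACA; congr (_ + _).
  by rewrite addrACA.
Qed.

Let vir_bracket_basisN x : vir_bracket x << None >> = 0.
Proof.
apply/eqP; rewrite -[_ == _](inj_eq (addrI (vir_bracket << None >> x))).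
rewrite vir_bracketC addr0 eq_sym; apply/eqP.
elim/virasoro_ind: x => [|a|c x IHx|x x' IHx IHx'].
- exact: vir_bracket0r.
- by rewrite vir_bracketU.
- by rewrite vir_bracketZr IHx scaler0.
- by rewrite vir_bracketDr IHx IHx' addr0.
Qed.

Let vir_bracket_basisNl x : vir_bracket << None >> x = 0.
Proof. by rewrite -[LHS]addr0 -(vir_bracket_basisN x) vir_bracketC. Qed.

Lemma vir_bracket_jacobi x y z :
  vir_bracket x (vir_bracket y z) + vir_bracket y (vir_bracket z x)
    + vir_bracket z (vir_bracket x y) = 0.
Proof.
rewrite -/(J x y z); apply: J_basis x => a; rewrite JC.
apply: J_basis y => b; rewrite JC; apply: J_basis z => c; rewrite JC /J.
have N0 := (vir_bracket_basisN, vir_bracket_basisNl, vir_bracket0l,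
            vir_bracket0r, addr0).
case: a b c => [a|] [b|] [c|]; rewrite ?N0 //.
rewrite -![<< Some _ >>]/(vir_L _) !vir_bracketLL !vir_bracketDr !vir_bracketZr.
rewrite !N0 !vir_bracketLL !scalerDr !scalerA.
have -> : b + (c + a) = a + (b + c) by ring.
have -> : c + (a + b) = a + (b + c) by ring.
rewrite !scaler0 !addr0.
rewrite [X in X + _]addrACA -!scalerDl addrACA -!scalerDl -!intrM -!intrD.
set s : int := (X in X%:~R *: vir_L _); have -> : s = 0 by rewrite /s; ring.
rewrite scale0r add0r.
case: eqP => [abc0|_]; last by rewrite !mulr0 !addr0 scale0r.
have -> : c = - a - b by lia.
rewrite !mulr1 !mulrA -!mulrDl -!intrM -!intrD.
set t : int := (X in X%:~R / 12); have -> : t = 0 by rewrite /t; ring.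
by rewrite mul0r scale0r.
Qed.

HB.instance Definition _ := Lmodule_isLieAlgebra.Build K (virasoro K)
  vir_bracket_bilinear vir_bracket_alternating vir_bracket_jacobi.

End Virasoro.

(* Main.v *)
(* For fixed z, the map f(_, z) is a delta-derivation of the Virasoro algebra,
   and so is f(z, _).  The algebra is perfect, so a delta-derivation with
   central values vanishes; in particular f kills C_0 on both sides when
   delta <> 0.  If D is a delta-derivation with D C_0 = 0 and a_n denotes the
   coefficient of L_(n+j) in D L_n, then for every shift j
     (m - n) a_(m+n) = delta ((m + j - n) a_m + (m - n - j) a_n).
   Taking (0, 1), (0, -1) and (1, -1) for (m, n) gives
   a_0 (delta - 1) (2 delta - 1) (delta + 1) = 0.  For delta = -1 another
   instance still gives a_0 = 0, and a_0 = 0 forces a = 0 unless delta = 1.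
   For delta = 1/2 the sequence a is constant, and the cocycle, which is cubic
   in n, forces that constant to vanish.  For delta = 1 one finds
   a_n = (j - n) b_j.  Applied to both arguments of f, this writes the
   coefficient of L_k in f(L_m, L_n) both as a multiple of k - 2m and as a
   multiple of k - 2n; evaluating at k = 2n leaves only k = m + n, with a
   single constant. *)

Require Import Defs.
From mathcomp Require Import all_boot all_order all_algebra.
From mathcomp Require Import all_classical reals.
From mathcomp Require Import complex freeg.
From mathcomp Require Import ring zify.

Set Implicit Arguments.
Unset Strict Implicit.
Unset Printing Implicit Defensive.

Import GRing.Theory Num.Theory.

Local Open Scope ring_scope.
Local Open Scope classical_set_scope.

(* Reduces [x = y] to the ring identity that exhibits [x - y] as a combination
   of the two sides of known equations. *)
Lemma eq_from_sub (V : zmodType) (x y u v : V) :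
  u = v -> x - y = u - v -> x = y.
Proof. by move=> ->; rewrite subrr => /subr0_eq. Qed.

(** * The scalar recurrence at a fixed shift *)

Section WeightRecurrence.
Variables (K : numFieldType) (delta : K) (j : int).

(* Here [a n] stands for the coefficient of [L_(n + j)] in [D L_n]. *)
Definition weight_rec (a : int -> K) := forall m n,
  (m - n)%:~R * a (m + n) =
    delta * ((m + j - n)%:~R * a m + (m - n - j)%:~R * a n).

Lemma intr_mulf_eq0 (m : int) (x : K) : m%:~R * x = 0 -> m != 0 -> x = 0.
Proof. by move/eqP; rewrite mulf_eq0 intr_eq0 => /orP[/eqP->//|/eqP]. Qed.

Lemma weight_rec0n a : weight_rec a -> forall n,
  (delta * (n + j)%:~R - n%:~R) * a n = delta * (j - n)%:~R * a 0.
Proof.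
by move=> ra n; have := ra 0 n; rewrite !add0r => /eq_from_sub; apply; ring.
Qed.

Lemma weight_rec_eq0 a :
  weight_rec a -> delta != 1 -> a 0 = 0 -> forall n, a n = 0.
Proof.
move=> ra d1 a0.
have aE n : (delta * (n + j)%:~R - n%:~R) * a n = 0.
  by rewrite (weight_rec0n ra) a0 mulr0.
(* By [aE], a_n can be nonzero only at the single root of an affine map. *)
have far n m : m != n -> a n != 0 -> a m = 0.
  move=> mn an.
  have /eqP := aE m; rewrite mulf_eq0 => /orP[/eqP Em|/eqP//].
  have /eqP := aE n; rewrite mulf_eq0 (negPf an) orbF -Em => /eqP En.
  have /eqP : (delta - 1) * (m - n)%:~R = 0.
    by apply: (eq_from_sub (esym En)); ring.
  rewrite mulf_eq0 subr_eq0 (negPf d1) intr_eq0 subr_eq0.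
  by rewrite (negPf mn).
move=> n; apply/eqP/negPn/negP => an.
(* With this [k], the indices [n + k] and [- k] sum to [n], are distinct, and both differ from
   [n]. *)
pose k : int := `|n| + 1.
have a1 : a (n + k) = 0 by apply: far an; lia.
have a2 : a (- k) = 0 by apply: far an; lia.
have := ra (n + k) (- k); rewrite a1 a2 addrK !mulr0 addr0 mulr0.
move/eqP; rewrite mulf_eq0 (negPf an) orbF intr_eq0 => /eqP; lia.
Qed.

Lemma weight_rec_a0 a : weight_rec a ->
  a 0 * ((delta - 1) * (2 * delta - 1) * (delta + 1)) = 0.
Proof.
move=> ra.
have E1 := weight_rec0n ra 1; have E2 := weight_rec0n ra (-1).
have := ra 1 (-1); rewrite subrr => E3.
have E x1 x2 x3 y1 y2 y3 (u v w : K) : x1 = y1 -> x2 = y2 -> x3 = y3 ->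
  u * x1 + v * x2 + w * x3 = u * y1 + v * y2 + w * y3.
  by move=> -> -> ->.
(* [p] and [q] are the coefficients of [a 1] and [a (-1)] in [E1] and [E2]. Eliminating both from
   [p * q] times [E3] cancels every [j]. *)
pose p := delta * (1 + j)%:~R - 1; pose q := delta * (j - 1)%:~R + 1.
apply: (@intr_mulf_eq0 (-2)) => //.
apply: (eq_from_sub (E _ _ _ _ _ _ (delta * (2 + j)%:~R * q)
  (delta * (2 - j)%:~R * p) (p * q) E1 E2 E3)).
by rewrite /p /q; ring.
Qed.

End WeightRecurrence.

Lemma weight_recN1_a0 (K : numFieldType) (j : int) (a : int -> K) :
  weight_rec (-1) j a -> a 0 = 0.
Proof.
move=> ra.
have aE n : (2 * n + j)%:~R * a n = (j - n)%:~R * a 0.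
  by apply: (eq_from_sub (esym (weight_rec0n ra n))); ring.
have [j0|j0] := eqVneq j 0.
  have h n : n != 0 -> a n = - a 0 / 2.
    move=> n0; apply/subr0_eq/(@intr_mulf_eq0 _ (2 * n)); last by lia.
    by apply: (eq_from_sub (aE n)); rewrite j0; field.
  have := ra 1 2; rewrite (h 1) // (h 2) // (h (1 + 2)) //.
  move/(congr1 ( *%R 2)) => E; apply: (@intr_mulf_eq0 _ 3) => //.
  by apply: (eq_from_sub E); rewrite j0; field.
(* The instance (j, 2j) of the recurrence reads 24 j a_0 = 0. *)
have h1 : a j = 0.
  apply: (@intr_mulf_eq0 _ (3 * j)); last by lia.
  by apply: (eq_from_sub (aE j)); ring.
have h2 : a (2 * j) = - a 0 / 5.
  apply/subr0_eq/(@intr_mulf_eq0 _ (5 * j)); last by lia.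
  by apply: (eq_from_sub (aE (2 * j))); field.
have h3 : a (j + 2 * j) = - (2 * a 0) / 7.
  apply/subr0_eq/(@intr_mulf_eq0 _ (7 * j)); last by lia.
  have -> : j + 2 * j = 3 * j by ring.
  by apply: (eq_from_sub (aE (3 * j))); field.
have := ra j (2 * j); rewrite h1 h2 h3 => /(congr1 ( *%R 35)) E.
apply: (@intr_mulf_eq0 _ (24 * j)); last by lia.
by apply: (eq_from_sub E); field.
Qed.

(** Constants solve the recurrence at [2^-1], so subtracting [a 0] reduces to a solution vanishing
    at 0. *)
Lemma weight_rec_half (K : numFieldType) (j : int) (a : int -> K) :
  weight_rec 2^-1 j a -> forall n, a n = a 0.
Proof.
move=> ra n; apply/subr0_eq.
have rb : weight_rec 2^-1 j (fun k => a k - a 0).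
  by move=> m k; apply: (eq_from_sub (ra m k)); field.
apply: (weight_rec_eq0 rb); last by rewrite subrr.
by rewrite invr_eq1 pnatr_eq1.
Qed.

Lemma weight_rec_neq1_half (K : numFieldType) (delta : K) (j : int)
    (a : int -> K) :
  weight_rec delta j a -> delta != 1 -> delta != 2^-1 -> forall n, a n = 0.
Proof.
move=> ra d1 d2; apply: weight_rec_eq0 (ra) (d1) _.
have /eqP := weight_rec_a0 ra.
rewrite !mulf_eq0 => /orP[/eqP//|/orP[/orP[]|]].
- by rewrite subr_eq0 (negPf d1).
- rewrite subr_eq0 => /eqP E; case/eqP: d2.
  by apply/subr0_eq/(@intr_mulf_eq0 _ 2) => //; apply: (eq_from_sub E); field.
- rewrite addr_eq0 => /eqP E; rewrite {}E in ra.
  exact: weight_recN1_a0 ra.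
Qed.

Lemma weight_rec1 (K : numFieldType) (j : int) (a : int -> K) :
  weight_rec 1 j a -> exists b, forall n, a n = (j - n)%:~R * b.
Proof.
move=> ra; have [j0|j0] := eqVneq j 0; last first.
  exists (a 0 / j%:~R) => n; apply/subr0_eq/(intr_mulf_eq0 _ j0).
  apply: (eq_from_sub (weight_rec0n ra n)); field.
  by rewrite intr_eq0.
exists (- a 1) => n.
have aD m k : m != k -> a (m + k) = a m + a k.
  move=> mk; apply/subr0_eq/(@intr_mulf_eq0 _ (m - k)); last by rewrite subr_eq0.
  by apply: (eq_from_sub (ra m k)); rewrite j0; ring.
have a0 : a 0 = 0 by have := aD 1 0 isT; rewrite addr0 -[LHS]addr0 => /addrI.
(* The pair (1, 1) carries no information, so 5 is split as 4 + 1 and as 3 + 2. *)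
have a2 : a 2 = a 1 + a 1.
  have := aD 4 1 isT.
  rewrite (aD 3 1) // (_ : 4 + 1 = 3 + 2 :> int) // (aD 3 2) //.
  by rewrite -addrA => /addrI.
have aS k : a (k + 1) = a k + a 1.
  by have [->|/aD//] := eqVneq k 1.
suff -> : a n = n%:~R * a 1 by rewrite j0; ring.
elim: n => [|n IHn|n IHn]; first by rewrite a0 mul0r.
- by rewrite -[n.+1]addn1 PoszD aS IHn; ring.
- apply/(addIr (a 1)); rewrite -aS -[n.+1]addn1 PoszD.
  have -> : - (n%:Z + 1) + 1 = - n%:Z by ring.
  by rewrite IHn; ring.
Qed.

(** * Unbundled linear maps *)

Section LinearPredicate.
Variables (K : pzRingType) (U W : lmodType K) (g : U -> W).
Hypothesis lg : linear g.

Lemma linear_predD x y : g (x + y) = g x + g y.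
Proof. by have := lg 1 x y; rewrite !scale1r. Qed.

Lemma linear_pred0 : g 0 = 0.
Proof. by apply: (addrI (g 0)); rewrite -linear_predD !addr0. Qed.

Lemma linear_predZ c x : g (c *: x) = c *: g x.
Proof. by have := lg c x 0; rewrite linear_pred0 !addr0. Qed.

End LinearPredicate.

Lemma linear_predBZ (K : comPzRingType) (U W : lmodType K) (g h : U -> W) c :
  linear g -> linear h -> linear (fun x => g x - c *: h x).
Proof.
move=> lg lh k x y; rewrite lg lh scalerDr opprD addrACA scalerBr.
by rewrite !scalerA mulrC.
Qed.

(** * Coefficients of brackets, and perfectness *)

Section Virasoro.
Variable K : numFieldType.
Local Notation V := (virasoro (K : fieldType)).
Local Notation L := (@vir_L K).
Local Notation C := (@vir_C K).

Definition vcoeff (a : option int) (x : virasoro K) : K := coeff a x.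

Lemma vcoeffD n (x y : V) : vcoeff n (x + y) = vcoeff n x + vcoeff n y.
Proof. exact: raddfD. Qed.

Lemma vcoeffZ n k (x : V) : vcoeff n (k *: x) = k * vcoeff n x.
Proof. exact: coeffZ. Qed.

Lemma vcoeff0 n : vcoeff n (0 : V) = 0.
Proof. exact: raddf0. Qed.

Lemma vcoeffL n m : vcoeff n (L m) = (Some m == n)%:R.
Proof. by rewrite /vcoeff coeffU mul1r. Qed.

Lemma vcoeffC n : vcoeff n C = (None == n)%:R.
Proof. by rewrite /vcoeff coeffU mul1r. Qed.

Lemma vir_bracketCr (x : V) : vir_bracket x C = 0.
Proof.
elim/virasoro_ind: x => [|a|k x IH|x y IHx IHy].
- exact: vir_bracket0l.
- by rewrite vir_bracketU; case: a.
- by rewrite vir_bracketZl IH scaler0.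
- by rewrite vir_bracketDl IHx IHy addr0.
Qed.

Lemma vir_bracketN (x y : V) : vir_bracket x y = - vir_bracket y x.
Proof. by apply/eqP; rewrite -addr_eq0 vir_bracketC. Qed.

Lemma vir_bracketCl (x : V) : vir_bracket C x = 0.
Proof. by rewrite vir_bracketN vir_bracketCr oppr0. Qed.

Lemma vcoeff_bracketL k (x : V) n :
  vcoeff (Some k) (vir_bracket x (L n)) =
    (k - n - n)%:~R * vcoeff (Some (k - n)) x.
Proof.
elim/virasoro_ind: x => [|[i|]|c x IH|x y IHx IHy].
- by rewrite vir_bracket0l !vcoeff0 mulr0.
- rewrite -/(L i) vir_bracketLL vcoeffD !vcoeffZ !vcoeffL vcoeffC mulr0 addr0.
  rewrite -[_ == Some k]/(i + n == k) -[_ == Some _]/(i == k - n).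
  rewrite eq_sym -subr_eq eq_sym.
  by case: eqP => [<-|_]; rewrite ?mulr0.
- by rewrite -/C vir_bracketCl vcoeff0 vcoeffC mulr0.
- by rewrite vir_bracketZl !vcoeffZ IH; ring.
- by rewrite vir_bracketDl !vcoeffD IHx IHy mulrDr.
Qed.

(** Only the [L (- n)] component of [x] meets the cocycle, whose value there is ((-n)^3 - (-n)) /
    12. *)
Lemma vcoeffC_bracketL (x : V) n :
  vcoeff None (vir_bracket x (L n)) =
    (n - n ^+ 3)%:~R / 12 * vcoeff (Some (- n)) x.
Proof.
elim/virasoro_ind: x => [|[i|]|c x IH|x y IHx IHy].
- by rewrite vir_bracket0l !vcoeff0 mulr0.
- rewrite -/(L i) vir_bracketLL vcoeffD !vcoeffZ !vcoeffL vcoeffC mulr0 add0r.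
  rewrite mulr1 -[_ == Some _]/(i == - n) addr_eq0.
  case: eqP => [->|_]; rewrite ?mulr0 //; congr (_%:~R / _ * _); ring.
- by rewrite -/C vir_bracketCl vcoeff0 vcoeffC mulr0.
- by rewrite vir_bracketZl !vcoeffZ IH; ring.
- by rewrite vir_bracketDl !vcoeffD IHx IHy mulrDr.
Qed.

Lemma vir_linear_eq0 (g : V -> V) : linear g ->
  (forall n, g (L n) = 0) -> g C = 0 -> forall x, g x = 0.
Proof.
move=> lg gL gC; elim/virasoro_ind => [|[n|]|c x IH|x y IHx IHy] //.
- exact: linear_pred0.
- exact: gL.
- by rewrite linear_predZ // IH scaler0.
- by rewrite linear_predD // IHx IHy addr0.
Qed.

(** Perfectness, in dual form: [L n] with [n] nonzero comes from [L_n, L_0], [L 0] from [L_1, L_-1],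
    where the cocycle vanishes, and [C] from [L_2, L_-2]. *)
Lemma vir_perfect (g : V -> V) : linear g ->
  (forall x y, g (vir_bracket x y) = 0) -> forall x, g x = 0.
Proof.
move=> lg g0.
have gLL m n : (m - n)%:~R *: g (L (m + n))
    + ((m ^+ 3 - m)%:~R / 12%:R * (m + n == 0)%:R) *: g C = 0.
  by rewrite -!(linear_predZ lg) -(linear_predD lg) -vir_bracketLL.
have gL n : g (L n) = 0.
  have [->|n0] := eqVneq n 0.
    have /eqP := gLL 1 (-1).
    rewrite expr1n subrr !mul0r scale0r addr0 scaler_eq0 => /orP[|/eqP//].
    by rewrite intr_eq0.
  have := gLL n 0; rewrite subr0 (negPf n0) mulr0 scale0r addr0.
  by move/eqP; rewrite scaler_eq0 intr_eq0 (negPf n0) => /eqP.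
apply: vir_linear_eq0 => //.
have /eqP := gLL 2 (-2).
rewrite gL scaler0 add0r mulr1 scaler_eq0 mulf_eq0 intr_eq0.
rewrite (_ : 12^-1 == 0 :> K = false) => [/eqP//|].
by rewrite invr_eq0 pnatr_eq0.
Qed.

(** * Delta-derivations of the Virasoro algebra *)

Section Derivation.
Variables (delta : K) (D : V -> V).
Hypothesis linD : linear D.
Hypothesis derD : forall x y,
  D (vir_bracket x y) =
    delta *: vir_bracket x (D y) + delta *: vir_bracket (D x) y.

Lemma central_derivation_eq0 :
  (forall x y, vir_bracket (D x) y = 0) -> forall x, D x = 0.
Proof.
move=> Dc; apply: vir_perfect linD _ => x y.
by rewrite derD Dc vir_bracketN Dc oppr0 !scaler0 addr0.
Qed.

Lemma derivation0_eq0 : delta = 0 -> forall x, D x = 0.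
Proof.
by move=> d0; apply: vir_perfect linD _ => x y; rewrite derD d0 !scale0r addr0.
Qed.

Hypothesis DC : D C = 0.

Lemma derivationLL m n : (m - n)%:~R *: D (L (m + n)) =
  delta *: vir_bracket (D (L m)) (L n) - delta *: vir_bracket (D (L n)) (L m).
Proof.
rewrite -scalerN -vir_bracketN [RHS]addrC -derD vir_bracketLL.
rewrite (linear_predD linD) !(linear_predZ linD).
by rewrite DC scaler0 addr0.
Qed.

Lemma derivation_weight_rec j :
  weight_rec delta j (fun n => vcoeff (Some (n + j)) (D (L n))).
Proof.
move=> m n; rewrite -vcoeffZ derivationLL -scaleN1r vcoeffD !vcoeffZ.
rewrite !vcoeff_bracketL.
have -> : m + n + j - n = m + j by ring.
have -> : m + n + j - m = n + j by ring.
ring.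
Qed.

Lemma coeff0_central (x : V) :
  (forall k, vcoeff (Some k) x = 0) -> forall y, vir_bracket x y = 0.
Proof.
move=> x0 y; suff -> : x = vcoeff None x *: C.
  by rewrite vir_bracketZl vir_bracketCl scaler0.
apply/eqP/freeg_eqP => a; rewrite -[RHS]/(vcoeff a _) vcoeffZ vcoeffC.
by case: a => [k|]; rewrite ?mulr1 // mulr0; exact: x0.
Qed.

Lemma derivation_coeff0_eq0 :
  (forall n k, vcoeff (Some k) (D (L n)) = 0) -> forall x, D x = 0.
Proof.
move=> D0; apply: vir_linear_eq0 linD _ DC => n.
(* These indices sum to [n], and their difference 3n + 2 is never zero on integers. *)
have := derivationLL (2 * n + 1) (- n - 1).
rewrite !coeff0_central // !scaler0 subrr => /eqP.
have -> : 2 * n + 1 + (- n - 1) = n by ring.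
rewrite scaler_eq0 intr_eq0 => /orP[/eqP|/eqP//]; lia.
Qed.

Lemma derivation_neq1_eq0 : delta != 1 -> forall x, D x = 0.
Proof.
move=> d1.
have [d2|d2] := eqVneq delta 2^-1; last first.
  apply: derivation_coeff0_eq0 => n k.
  have := weight_rec_neq1_half (derivation_weight_rec (k - n)) d1 d2 n.
  by rewrite addrC subrK.
have ra j n : vcoeff (Some (n + j)) (D (L n)) = vcoeff (Some j) (D (L 0)).
  have := derivation_weight_rec j; rewrite d2 => /weight_rec_half ->.
  by rewrite add0r.
suff a0 s : vcoeff (Some (- s)) (D (L 0)) = 0.
  apply: derivation_coeff0_eq0 => n k.
  by rewrite -[k](subrK n) addrC ra -opprB a0.
(* The coefficients of C_0: after division by m - n, the right-hand side still
   depends on m - n, while the left-hand side depends on s only. *)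
have E m n : m + n = s -> (m - n)%:~R * vcoeff None (D (L s)) =
    2^-1 * ((n - n ^+ 3)%:~R - (m - m ^+ 3)%:~R) / 12
      * vcoeff (Some (- s)) (D (L 0)).
  move=> <-; rewrite -vcoeffZ derivationLL -scaleN1r vcoeffD !vcoeffZ.
  rewrite !vcoeffC_bracketL.
  rewrite (_ : - n = m + - (m + n)) 1?ra; last by ring.
  rewrite (_ : - m = n + - (m + n)) 1?ra; last by ring.
  by rewrite d2; field.
(* This size makes both differences, s + 2t and s + 2t + 2, positive. Eliminating [u] between [E1]
   and [E2] leaves a nonzero multiple of [v]. *)
pose t : int := `|s| + 1.
have E1 := E (s + t) (- t) (addrK _ _).
have E2 := E (s + (t + 1)) (- (t + 1)) (addrK _ _).
set u := vcoeff None _ in E1 E2; set v := vcoeff _ _ in E1 E2 *.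
apply: (@intr_mulf_eq0 _ ((s + 2 * t) * (s + 2 * t + 2) * (s + 2 * t + 1)));
  last by rewrite !mulf_neq0 //; lia.
have e x1 y1 x2 y2 (p q : K) : x1 = y1 -> x2 = y2 ->
  p * x1 + q * x2 = p * y1 + q * y2 by move=> -> ->.
by apply: (eq_from_sub (e _ _ _ _ (24 * (s + 2 * t + 2)%:~R)
  (- 24 * (s + 2 * t)%:~R) E1 E2)); field.
Qed.

End Derivation.

(** * Multiples of the bracket, and the classification of biderivations *)

Lemma vir_bracket_leibniz (x y z : V) :
  vir_bracket (vir_bracket x y) z =
    vir_bracket x (vir_bracket y z) + vir_bracket (vir_bracket x z) y.
Proof.
have -> : vir_bracket (vir_bracket x z) y = vir_bracket y (vir_bracket z x).
  rewrite vir_bracketN [vir_bracket x z]vir_bracketN -[- vir_bracket z x]scaleN1r.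
  by rewrite vir_bracketZr scaleN1r opprK.
apply/eqP; rewrite vir_bracketN -subr_eq0 -[_ == 0]oppr_eq0 opprB opprK.
exact/eqP/vir_bracket_jacobi.
Qed.

Lemma vir_bracket_leibnizr (x y z : V) :
  vir_bracket x (vir_bracket y z) =
    vir_bracket y (vir_bracket x z) + vir_bracket (vir_bracket x y) z.
Proof.
rewrite vir_bracket_leibniz [vir_bracket _ y]vir_bracketN.
by rewrite addrCA subrr addr0.
Qed.

Lemma biderivation1_scale (c : K) :
  delta_biderivation 1 (fun x y : V => c *: vir_bracket x y).
Proof.
have scaleS (g : V -> V) : linear g -> linear (fun x => c *: g x).
  by move=> lg k x y; rewrite lg scalerDr !scalerA mulrC.
split=> [|x y z|x y z].
- split=> x; apply: scaleS; first exact: (vir_bracket_bilinear K).1.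
  exact: (vir_bracket_bilinear K).2.
- rewrite !scale1r.
  rewrite -[LHS]/(vir_bracket x (c *: vir_bracket y z)
    + vir_bracket (c *: vir_bracket x z) y).
  by rewrite vir_bracketZr vir_bracketZl -scalerDr -vir_bracket_leibniz.
- rewrite !scale1r.
  rewrite -[LHS]/(vir_bracket (c *: vir_bracket x y) z
    + vir_bracket y (c *: vir_bracket x z)).
  by rewrite vir_bracketZr vir_bracketZl -scalerDr addrC -vir_bracket_leibnizr.
Qed.

Lemma delta_biderivation0 (delta : K) :
  delta_biderivation delta (0 : V -> V -> V).
Proof.
split=> [|x y z|x y z]; first split=> x c y z.
- by rewrite -[RHS]/(c *: 0 + 0) scaler0 addr0.
- by rewrite -[RHS]/(c *: 0 + 0) scaler0 addr0.
- rewrite -[LHS]/(delta *: vir_bracket x 0 + delta *: vir_bracket 0 y).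
  by rewrite vir_bracket0r vir_bracket0l scaler0 addr0.
- rewrite -[LHS]/(delta *: vir_bracket 0 z + delta *: vir_bracket y 0).
  by rewrite vir_bracket0r vir_bracket0l scaler0 addr0.
Qed.

(** The two defining identities are exchanged, so results on the first argument carry over to the
    second. *)
Lemma delta_biderivation_flip (delta : K) (f : V -> V -> V) :
  delta_biderivation delta f -> delta_biderivation delta (fun x y => f y x).
Proof.
case=> [[fl fr] H1 H2]; split; first by split.
- by move=> x y z; rewrite addrC H2.
- by move=> x y z; rewrite addrC H1.
Qed.

Lemma delta_biderivation_derl (delta : K) (f : V -> V -> V) z :
  delta_biderivation delta f -> forall x y,
  f (vir_bracket x y) z =
    delta *: vir_bracket x (f y z) + delta *: vir_bracket (f x z) y.
Proof. by case=> _ H _ x y; rewrite -[LHS]H. Qed.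

(** Expanding [f] at [C, x] = 0 shows that [f C y] is central; then [f C] is a delta-derivation with
    central values. *)
Lemma delta_biderivation_C0 (delta : K) (f : V -> V -> V) :
  delta_biderivation delta f -> delta != 0 -> forall y, f C y = 0.
Proof.
move=> bf d0; have := delta_biderivation_flip bf => bg.
have [[fl fr] _ _] := bf.
apply: (central_derivation_eq0 (fr C) (delta_biderivation_derl C bg)) => y x.
have := delta_biderivation_derl y bf C x; rewrite !vir_bracketCl scaler0 add0r.
rewrite (linear_pred0 (fl y)) => /esym/eqP.
by rewrite scaler_eq0 (negPf d0) => /eqP.
Qed.

Lemma delta_biderivation_neq1 (delta : K) (f : V -> V -> V) :
  delta_biderivation delta f -> delta != 1 -> forall x y, f x y = 0.
Proof.
move=> bf d1 x y; have [[fl _] _ _] := bf.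
have dl := delta_biderivation_derl y bf.
have [d0|d0] := eqVneq delta 0; first exact: (derivation0_eq0 (fl y) dl d0).
exact: (derivation_neq1_eq0 (fl y) dl (delta_biderivation_C0 bf d0 y) d1).
Qed.

(** [b n j] is the constant given by [weight_rec1] for the derivation f(_, L_n) at shift [j]. *)
Lemma biderivation_weight (f : V -> V -> V) : delta_biderivation 1 f ->
  exists b : int -> int -> K, forall m n j,
    vcoeff (Some (m + j)) (f (L m) (L n)) = (j - m)%:~R * b n j.
Proof.
move=> bf; have [[fl _] _ _] := bf.
suff /choice[b bE] n : exists b : int -> K, forall j m,
    vcoeff (Some (m + j)) (f (L m) (L n)) = (j - m)%:~R * b j.
  by exists b => m n.
suff /choice[b bE] j : exists c : K, forall m,
    vcoeff (Some (m + j)) (f (L m) (L n)) = (j - m)%:~R * c by exists b.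
apply: weight_rec1 (derivation_weight_rec (fl (L n)) _ _ j).
  exact: delta_biderivation_derl.
by apply: delta_biderivation_C0 bf _ _; rewrite oner_eq0.
Qed.

Lemma biderivation1 (f : V -> V -> V) : delta_biderivation 1 f ->
  exists c : K, forall x y, f x y = c *: vir_bracket x y.
Proof.
move=> bf; have [[fl fr] _ _] := bf; have bg := delta_biderivation_flip bf.
have [b bE] := biderivation_weight bf.
have [b' /= b'E] := biderivation_weight bg.
(* With m = 2n - l, the coefficient of L_(2n) in f(L_m, L_n) is 2(l - n) [b n l] from one side and 0
   from the other. *)
have b_off n l : l != n -> b n l = 0.
  move=> ln; have [m e] : exists m, n + n = m + l.
    by exists (n + n - l); rewrite subrK.
  have := b'E n m n; rewrite subrr mul0r e bE => /intr_mulf_eq0; apply; lia.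
have b_diag m n : m != n -> b n n = - b' m m.
  move=> mn; have := b'E n m m; rewrite addrC bE => E.
  apply/subr0_eq/(@intr_mulf_eq0 _ (n - m)); first by apply: (eq_from_sub E); ring.
  by rewrite subr_eq0 eq_sym.
(* The index [|n| + 1] differs from both [n] and 0, so it links the two diagonal values. *)
have b00 n : b n n = b 0 0.
  by rewrite (b_diag (`|n| + 1) n) ?(b_diag (`|n| + 1) 0) //; lia.
exists (- b 0 0).
have fC x : f x C = 0.
  by apply: delta_biderivation_C0 bg _ _; rewrite oner_eq0.
(* The difference of the two sides is a derivation in [x]; once its L-coefficients vanish,
   [derivation_coeff0_eq0] also removes the central part. *)
have fL n x : f x (L n) = - b 0 0 *: vir_bracket x (L n).
  apply/subr0_eq; move: x.
  apply: (@derivation_coeff0_eq0 1 (fun x => f x (L n) - _ *: vir_bracket x (L n))).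
  - apply: linear_predBZ; first exact: fl.
    exact: (vir_bracket_bilinear K).1.
  - move=> x y; rewrite !scale1r (delta_biderivation_derl _ bf) !scale1r.
    rewrite vir_bracket_leibniz -!scaleNr.
    rewrite vir_bracketDr vir_bracketDl vir_bracketZr vir_bracketZl.
    by rewrite scalerDr addrACA.
  - by rewrite (delta_biderivation_C0 bf) ?oner_eq0 // vir_bracketCl scaler0 subr0.
  move=> m k; rewrite -scaleNr vcoeffD vcoeffZ vcoeff_bracketL vcoeffL.
  have [j ->] : exists j, k = m + j by exists (k - m); rewrite addrC subrK.
  rewrite bE opprK -[_ == Some _]/(m == m + j - n).
  rewrite eq_sym subr_eq (inj_eq (addrI m)).
  by case: eqP => [->|/eqP/b_off->]; rewrite ?b00 /=; ring.
move=> x y; apply/subr0_eq; move: y.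
apply: (@vir_linear_eq0 (fun y => f x y - _ *: vir_bracket x y)).
- exact: linear_predBZ (fr x) ((vir_bracket_bilinear K).2 x).
- by move=> n; rewrite fL subrr.
- by rewrite fC vir_bracketCr scaler0 subr0.
Qed.

End Virasoro.

Theorem theorem4p2 (R : realType) (delta : R[i]) :
  delta_biderivations (virasoro R[i]) delta =
    if delta == 1 then
      [set c *: (fun x y : virasoro R[i] => [lie x, y]) | c in [set: R[i]]]
    else [set 0].
Proof.
apply/seteqP; split => f /=.
- move=> bf; have [d1|d1] := eqVneq delta 1.
    rewrite d1 in bf.
    have [c cE] := biderivation1 bf; exists c => //.
    by apply/funext => x; apply/funext => y; rewrite cE.
  by apply/funext => x; apply/funext => y; rewrite (delta_biderivation_neq1 bf).
- case: eqVneq => [->|_].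
    by move=> [c _ <-]; exact: biderivation1_scale.
  by move=> ->; exact: delta_biderivation0.
Qed.
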